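(* Write a creation sequence $(b_1,\ldots,b_7)$ as the binary string $b_1b_2\cdots b_7$. The connected threshold graphs $G$ of order $7$ with the following creation sequences have the following values of $q(G)$. (i) $q(G)=4$ for the creation sequence $0001001$. (ii) $q(G)=2$ for each of the creation sequences $0101011$, $0100111$, $0011011$, $0010111$, $0001111$, $0101111$, $0110111$, $0111011$, $0111111$. (iii) $q(G)=3$ for each of the creation sequences $0000001$, $0100001$, $0010001$, $0000101$, $0000011$, $0110001$, $0101001$, $0100101$, $0100011$, $0011001$, $0010101$, $0010011$, $0001101$, $0001011$, $0000111$, $0111001$, $0110101$, $0110011$, $0101101$, $0011101$, $0111101$.
   Context: For a simple graph $G$ on $n$ vertices, $S(G)$ is the set of all real symmetric $n\times n$ matrices $A=(a_{ij})$ such that for $i\neq j$, $a_{ij}\neq 0$ if and only if $ij\in E(G)$ (diagonal entries are unrestricted). $q(A)$ is the number of distinct eigenvalues of $A$ and $q(G)=\min\{q(A): A\in S(G)\}$. The threshold graph with creation sequence $(b_1,\ldots,b_n)$, where $b_i\in\{0,1\}$ and $b_1=0$, has vertices $v_1,\ldots,v_n$ and, for $i<j$, $v_i$ and $v_j$ are adjacent if and only if $b_j=1$; connected threshold graphs are those with $b_n=1$. *)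

(* Defs.v *)
From mathcomp Require Import all_boot all_order all_algebra finmap.
From mathcomp Require Import boolp classical_sets cardinality reals.

Set Implicit Arguments.
Unset Strict Implicit.
Unset Printing Implicit Defensive.

Import GRing.Theory.

Local Open Scope classical_set_scope.
Local Open Scope ring_scope.

Record sgraph (n : nat) := SGraph {
  adj :> rel 'I_n;
  adj_sym : symmetric adj;
  adj_irrefl : irreflexive adj
}.

Definition sym_matrices (R : realType) (n : nat) (G : sgraph n) :
    set 'M[R]_n :=
  [set A | A^T = A /\ forall i j, i != j -> (A i j != 0) = G i j].
Arguments sym_matrices R [n] G _.

(* The eigenvalues are those in R; a real symmetric matrix has no others. *)
Definition eigenvalues (R : realType) (n : nat) (A : 'M[R]_n) : set R :=
  [set a | eigenvalue A a].

(* fset_set returns the empty set on infinite sets; this rules that case out. *)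
Lemma finite_eigenvalues (R : realType) (n : nat) (A : 'M[R]_n) :
  finite_set (eigenvalues A).
Proof.
apply: contrapT => /(@infinite_set_fset _ _ n.+1)[X XA sX].
have p0 : char_poly A != 0 by rewrite monic_neq0 ?char_poly_monic.
have : (size (enum_fset X) < size (char_poly A))%N.
  apply: max_poly_roots (fset_uniq X) => //; apply/allP => a /XA.
  by rewrite /eigenvalues /= eigenvalue_root_char.
by rewrite size_char_poly ltnS leqNgt sX.
Qed.

Definition q_mx (R : realType) (n : nat) (A : 'M[R]_n) : nat :=
  #|` fset_set (eigenvalues A)|%fset.

Definition q_values (R : realType) (n : nat) (G : sgraph n) : set nat :=
  [set q_mx A | A in sym_matrices R G].
Arguments q_values R [n] G _.

Lemma q_values_neq0 (R : realType) (n : nat) (G : sgraph n) :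
  exists k, `[< q_values R G k >].
Proof.
pose A : 'M[R]_n := \matrix_(i, j) (G i j)%:R.
exists (q_mx A); apply/asboolP; exists A => //; split=> [|i j _].
  by apply/matrixP => i j; rewrite !mxE adj_sym.
by rewrite mxE; case: (G i j); rewrite ?oner_eq0 ?eqxx.
Qed.

Definition q_graph (R : realType) (n : nat) (G : sgraph n) : nat :=
  ex_minn (q_values_neq0 R G).

(* Vertices are numbered from 0, so b_(i+1) is nth false b i; b_1 is never
   read, hence the convention b_1 = 0 needs no enforcing. *)
Definition threshold_adj (b : seq bool) : rel 'I_(size b) :=
  fun i j => ((i < j)%N && nth false b j) || ((j < i)%N && nth false b i).

Lemma threshold_adj_sym (b : seq bool) : symmetric (@threshold_adj b).
Proof. by move=> i j; rewrite /threshold_adj orbC. Qed.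

Lemma threshold_adj_irrefl (b : seq bool) : irreflexive (@threshold_adj b).
Proof. by move=> i; rewrite /threshold_adj ltnn. Qed.

Definition threshold_graph (b : seq bool) : sgraph (size b) :=
  SGraph (@threshold_adj_sym b) (@threshold_adj_irrefl b).

(* Number.uint keeps the leading zeros of a numeral, so that bits 0110 is the
   sequence of bits 0, 1, 1, 0; only numerals with digits 0 and 1 are meant. *)
Fixpoint dec_bits (u : Decimal.uint) : seq bool :=
  match u with
  | Decimal.Nil => [::]
  | Decimal.D0 u => false :: dec_bits u
  | Decimal.D1 u | Decimal.D2 u | Decimal.D3 u | Decimal.D4 u | Decimal.D5 u
  | Decimal.D6 u | Decimal.D7 u | Decimal.D8 u | Decimal.D9 u =>
      true :: dec_bits u
  end.

Definition bits (u : Number.uint) : seq bool :=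
  if u is Number.UIntDecimal d then dec_bits d else [::].
Arguments bits u%_dec_uint_scope.

Fact bits_0110 : bits 0110 = [:: false; true; true; false].
Proof. by []. Qed.

(* Main.v *)
Require Import Defs.
From mathcomp Require Import all_boot all_order all_algebra finmap.
From mathcomp Require Import boolp classical_sets cardinality reals.
From mathcomp Require Import complex ring lra.

(* By the spectral theorem the minimal polynomial of a real symmetric matrix A
   has simple real roots, so q(A) is its degree.  Upper bounds on q(G) therefore
   follow from integer matrices in S(G) annihilated by a polynomial of the right
   degree.  In the other direction, q(A) <= k makes A^k a linear combination of
   1, A, ..., A^(k-1), and we look at off-diagonal entries.  For k = 2, the rows
   of an independent set whose pairwise common neighbours lie in a smaller set J
   would be too many orthogonal nonzero vectors in R^J.  For k = 3 and 0001001,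
   the entries force the coefficient of A, computed in two ways, to have both
   signs. *)

Set Implicit Arguments.
Unset Strict Implicit.
Unset Printing Implicit Defensive.

Import Order.TTheory GRing.Theory Num.Theory.

Local Open Scope classical_set_scope.
Local Open Scope ring_scope.

(** * Eigenvalue count and minimal polynomial of a real symmetric matrix *)

(** Over the complex numbers the matrix is unitarily similar to a diagonal one with real entries, so
    its minimal polynomial is the product of ['X - a%:P] over the distinct real eigenvalues. Minimal
    polynomials commute with field extension, so the factorization descends to [R]. *)
Lemma q_mx_sym (R : realType) (n : nat) (A : 'M[R]_n.+1) :
  A^T = A -> q_mx A = degree_mxminpoly A.
Proof.
move=> sA; pose AC := map_mx (real_complex R) A.
have realAC : AC \is a mxOver Num.real.
  by apply/mxOverP => i j; rewrite mxE; apply/complex_realP; exists (A i j).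
have hermAC : AC \is hermsymmx.
  apply: realsym_hermsym => //; apply/is_hermitianmxP.
  by rewrite expr0 scale1r map_mx_id // /AC map_trmx sA.
have AC_eq := orthomx_spectralP (hermitian_normalmx hermAC).
have /mxOverP d_real := hermitian_spectral_diag_real hermAC.
set d := spectral_diag AC in AC_eq d_real.
have /choice[r dr] : forall i, exists x, d 0 i = real_complex R x.
  by move=> i; apply/complex_realP.
pose s := undup [seq r i | i <- enum 'I_n.+1].
have pA : mxminpoly A = \prod_(a <- s) ('X - a%:P).
  apply: (map_poly_inj (real_complex R)).
  rewrite -mxminpoly_map -/AC {1}AC_eq -conjVmx ?spectral_unit //.
  rewrite mxminpoly_uconj ?unitmx_inv ?spectral_unit // mxminpoly_diag.
  rewrite (eq_map dr) (map_comp (real_complex R)) undup_map_inj; last first.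
    exact: complexI.
  rewrite big_map rmorph_prod; apply: eq_bigr => a _.
  by rewrite rmorphB /= map_polyX map_polyC.
have eigA : eigenvalues A = [set` [fset a in s]%fset].
  apply/seteqP; split=> a;
    rewrite /eigenvalues /= in_fset eigenvalue_root_min pA.
    by rewrite root_prod_XsubC.
  by rewrite root_prod_XsubC.
apply: succn_inj; rewrite -size_mxminpoly pA size_prod_XsubC.
rewrite /q_mx eigA set_fsetK.
by rewrite card_fseq undup_id ?undup_uniq.
Qed.

Lemma q_mx_le (R : realType) (n : nat) (A : 'M[R]_n.+1) (p : {poly R}) :
  A^T = A -> p != 0 -> horner_mx A p = 0 -> (q_mx A < size p)%N.
Proof.
move=> sA p0 pA0; rewrite q_mx_sym // -size_mxminpoly.
exact/dvdp_leq/mxminpoly_min.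
Qed.

(** The [c i] are the coefficients of the remainder of ['X^k] modulo the minimal polynomial, whose
    degree is at most [k]. *)
Lemma expmx_q_mx_le (R : realType) (n : nat) (A : 'M[R]_n.+1) (k : nat) :
  A^T = A -> (q_mx A <= k)%N ->
  exists c : nat -> R, A ^+ k = \sum_(i < k) c i *: A ^+ i.
Proof.
move=> sA; rewrite q_mx_sym // => qk; pose p := 'X^k %% mxminpoly A.
exists (fun i => p`_i); transitivity (horner_mx A p).
  have /(congr1 (horner_mx A)) := divp_eq 'X^k (mxminpoly A).
  rewrite rmorphXn /= horner_mx_X rmorphD rmorphM /= mx_root_minpoly.
  by rewrite mulr0 add0r.
have pk : (size p <= k)%N by apply: leq_trans (size_mod_mxminpoly _ _) qk.
rewrite -{1}[p]coefK (poly_def (size p)) rmorph_sum /=.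
rewrite (big_ord_widen k (fun i => horner_mx A (p`_i *: 'X^i))) //.
rewrite big_mkcond /=.
apply: eq_bigr => i _; case: ifP => [_|/negbT].
  by rewrite linearZ /= rmorphXn /= horner_mx_X.
by rewrite -leqNgt => /(nth_default 0) ->; rewrite scale0r.
Qed.

(** * Bounds on [q_graph] for arbitrary graphs *)

Lemma q_graph_le (R : realType) (n : nat) (G : sgraph n) (A : 'M[R]_n)
    (k : nat) :
  sym_matrices R G A -> (q_mx A <= k)%N -> (q_graph R G <= k)%N.
Proof.
move=> GA; apply: leq_trans; rewrite /q_graph; case: ex_minnP => m _; apply.
by apply/asboolP; exists A.
Qed.

Lemma q_graph_gt (R : realType) (n : nat) (G : sgraph n) (k : nat) :
  (forall A, sym_matrices R G A -> ~~ (q_mx A <= k)%N) -> (k < q_graph R G)%N.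
Proof.
move=> Gk; rewrite /q_graph; case: ex_minnP => m /asboolP[A GA <-] _.
by rewrite ltnNge Gk.
Qed.

(** A symmetric matrix with at most one eigenvalue is scalar, which an edge forbids. *)
Lemma q_graph_gt1 (R : realType) (n : nat) (G : sgraph n.+1) (i j : 'I_n.+1) :
  G i j -> (1 < q_graph R G)%N.
Proof.
move=> Gij; apply: q_graph_gt => A [sA GA].
apply/negP => /(expmx_q_mx_le sA)[c].
rewrite big_ord1 expr1 => A_scal.
have ij : i != j by apply/eqP => eij; move: Gij; rewrite eij adj_irrefl.
have := GA i j ij; rewrite Gij A_scal expr0 !mxE (negPf ij) mulr0n mulr0.
by rewrite eqxx.
Qed.

(** Let [M] be the submatrix of [A] with rows [I] and columns [J]. If [A ^+ 2] is a combination of 1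
    and [A], then [M *m M^T] is diagonal, and the neighbours in [J] make its diagonal nonzero. It
    then has rank [#|I|], although the rank of [M] is at most [#|J|]. *)
Lemma q_graph_gt2 (R : realType) (n : nat) (G : sgraph n.+1)
    (I J : {set 'I_n.+1}) :
  (#|J| < #|I|)%N ->
  (forall i, i \in I -> exists2 j, j \in J & G i j) ->
  (forall i i', i \in I -> i' \in I -> i != i' ->
     ~~ G i i' /\ forall k, G i k -> G i' k -> k \in J) ->
  (2 < q_graph R G)%N.
Proof.
move=> JI IJ I_indep; apply: q_graph_gt => A [sA GA].
apply/negP => /(expmx_q_mx_le sA)[c].
rewrite !big_ord_recl big_ord0 /= addr0 => A2.
have symA i j : A i j = A j i by rewrite -{1}sA mxE.
have A0 i j : i != j -> ~~ G i j -> A i j = 0.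
  by move=> /GA <-; rewrite negbK => /eqP.
pose M : 'M[R]_(#|I|, #|J|) := \matrix_(i, j) A (enum_val i) (enum_val j).
have MMT i i' : (M *m M^T) i i' =
    \sum_(k in J) A (enum_val i) k * A (enum_val i') k.
  rewrite mxE (big_enum_val (fun k => A (enum_val i) k * A (enum_val i') k)).
  by apply: eq_bigr => k _; rewrite !mxE.
have MMT_offdiag i i' : i != i' -> (M *m M^T) i i' = 0.
  rewrite -(inj_eq enum_val_inj) => ii'.
  have [nG common] := I_indep _ _ (enum_valP i) (enum_valP i') ii'.
  transitivity ((A ^+ 2) (enum_val i) (enum_val i')); last first.
    by rewrite A2 expr0 expr1 !mxE (negPf ii') (A0 _ _ ii') // !mulr0 addr0.
  rewrite MMT [RHS]mxE [RHS](bigID (mem J)) /= [X in _ + X]big1 ?addr0.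
    by apply: eq_bigr => k _; rewrite [A k _]symA.
  (* Outside [J], [k] is one of the two vertices or is not a common neighbour; in each case one
     factor vanishes. *)
  move=> k kJ.
  have [<-|ik] := eqVneq (enum_val i) k.
    by rewrite [X in _ * X]A0 ?mulr0.
  have [<-|i'k] := eqVneq (enum_val i') k.
    by rewrite [X in X * _]A0 ?mul0r.
  have [Gik|nGik] := boolP (G (enum_val i) k); last by rewrite A0 ?mul0r.
  rewrite [X in _ * X]A0 ?mulr0 1?eq_sym //.
  by rewrite adj_sym; apply: contra kJ; apply: common.
have MMT_diag i : (M *m M^T) i i != 0.
  have [k kJ Gik] := IJ _ (enum_valP i).
  rewrite MMT gt_eqF // (bigD1 k) //= ltr_pwDl ?sumr_ge0 //; last first.
    by move=> j _; rewrite -expr2 sqr_ge0.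
  rewrite -expr2 lt_neqAle sqr_ge0 andbT eq_sym expf_neq0 // GA //.
  by apply: contraTneq Gik => ->; rewrite adj_irrefl.
have MMT_unit : M *m M^T \in unitmx.
  have -> : M *m M^T = diag_mx (\row_i (M *m M^T) i i).
    apply/matrixP => i i'; rewrite [RHS]mxE [X in X *+ _]mxE.
    by have [->|/MMT_offdiag ->] := eqVneq i i'.
  rewrite unitmxE det_diag unitfE; apply/prodf_neq0 => i _.
  by rewrite mxE.
have := leq_trans (mxrankM_maxl M M^T) (rank_leq_col M).
by rewrite mxrank_unit // leqNgt JI.
Qed.

(** * Lower bounds for threshold graphs *)

Lemma card_ord_nth (b : seq bool) (s : nat) (p : pred bool) :
  #|[set i : 'I_(size b) | (s <= i)%N && p (nth false b i)]%SET| =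
  count p (drop s b).
Proof.
rewrite -sum1_card.
rewrite (eq_bigl (fun i : 'I_(size b) => (s <= i)%N && p (nth false b i)));
  last first.
  by move=> i; rewrite inE.
rewrite -(big_mkord (fun i => (s <= i)%N && p (nth false b i)) (fun=> 1%N)).
rewrite sum1_count /index_iota subn0.
elim: b s => [|x b IHb] s /=; first by [].
rewrite (iotaDl 1 0) count_map.
case: s => [|s] /=; first by have := IHb 0; rewrite drop0 => <-.
by rewrite add0n -IHb.
Qed.

(** Here [J] consists of the 1s of the suffix, and the independent set of its 0s and the first
    vertex. The latter lies before the suffix and makes the inequality of cardinals strict. *)
Lemma q_threshold_gt2 (R : realType) (b : seq bool) (s : nat) :
  (0 < s < size b)%N -> last false b ->
  (count id (drop s b) <= count negb (drop s b))%N ->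
  (2 < q_graph R (threshold_graph b))%N.
Proof.
case: b => [|x b] //; set b' := x :: b => /andP[s0 sb] lastb cb.
pose J := [set i : 'I_(size b').-1.+1 | (s <= i)%N && nth false b' i]%SET.
pose I := [set i : 'I_(size b').-1.+1 | (s <= i)%N && ~~ nth false b' i]%SET.
have lastE : nth false b' (size b) by rewrite -[size b]/(size b').-1 nth_last.
apply: (@q_graph_gt2 R (size b').-1 (threshold_graph b') (ord0 |: I) J).
- rewrite cardsU1.
  have -> : ord0 \notin I by rewrite inE negb_and -ltnNge s0.
  by rewrite (card_ord_nth b' s id) (card_ord_nth b' s negb).
(* The last vertex dominates all others and lies in [J]. *)
- move=> i iI; exists ord_max; first by rewrite inE lastE andbT -ltnS.
  have i_last : (i < size b)%N.
    rewrite ltn_neqAle -ltnS ltn_ord andbT; apply/eqP => ib.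
    move: iI; rewrite !inE -val_eqE /= ib lastE andbF orbF => /eqP b0.
    by move: sb s0; rewrite /= b0; case: (s).
  by rewrite /= /threshold_adj /= i_last lastE.
(* No vertex of the independent set dominates an earlier one, so a common neighbour [k] comes after
   both [i] and [i']. One of these is not [ord0], hence lies in the suffix, and so does [k]. *)
- have nonadj (i k : 'I_(size b').-1.+1) : i \in ord0 |: I ->
    (k < i)%N -> ~~ nth false b' i.
    rewrite !inE => /orP[/eqP-> //|/andP[_ ->] //].
  move=> i i' iI i'I ii'; split.
    rewrite /= /threshold_adj negb_or !negb_and.
    by case: ltngtP => //= [/(nonadj _ _ i'I)->|/(nonadj _ _ iI)->].
  move=> k; rewrite /= /threshold_adj.
  case: (ltngtP i k) => // [ik|ki]; last first.
    by rewrite (negPf (nonadj _ _ iI ki)).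
  case: (ltngtP i' k) => // [i'k|ki']; last first.
    by rewrite (negPf (nonadj _ _ i'I ki')) andbF.
  rewrite !orbF /= => bk _; rewrite inE bk andbT.
  move: iI i'I; rewrite !inE.
  move=> /orP[/eqP i0|/andP[si _] _]; last exact: leq_trans si (ltnW ik).
  move=> /orP[/eqP i'0|/andP[si' _]]; last exact: leq_trans si' (ltnW i'k).
  by move: ii'; rewrite i0 i'0 eqxx.
Qed.

Lemma q_threshold_gt1 (R : realType) (b : seq bool) :
  (1 < size b)%N -> last false b -> (1 < q_graph R (threshold_graph b))%N.
Proof.
case: b => [|x [|y b]] // _ lastb.
apply: (@q_graph_gt1 _ _ (threshold_graph [:: x, y & b]) ord0 ord_max).
have lastE : nth false (y :: b) (size b).
  by rewrite -[size b]/(size (y :: b)).-1 nth_last.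
by rewrite /= /threshold_adj /= lastE.
Qed.

(** * Upper bounds from integer matrices checked by computation *)

(* [T] lists the rows of the upper triangle, each one from its diagonal entry
   onwards. *)
Definition sym_entry (T : seq (seq int)) (i j : nat) : int :=
  nth 0 (nth [::] T (minn i j)) (maxn i j - minn i j).

(* A polynomial is the list [p] of its coefficients, constant term first. *)
Definition horner_entry (n : nat) (f : nat -> nat -> int) (p : seq int) :
    nat -> nat -> int :=
  foldr (fun c g i j => foldr (fun k x => g i k * f k j + x)
                          (if i == j then c else 0) (iota 0 n))
    (fun _ _ => 0) p.

Arguments horner_entry : simpl never.

(** All data are integers, so the test is decided by evaluation. The condition on [last 0 p] makes
    [(size p).-1] the degree of the polynomial. Only positions above the diagonal are compared with
    [b], as [sym_entry] is symmetric. *)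
Definition annihilated_certificate (b : seq bool) (T : seq (seq int))
    (p : seq int) : bool :=
  [&& (0 < size b)%N, last 0 p != 0,
      all (fun j => all (fun i => (sym_entry T i j != 0) == nth false b j)
                      (iota 0 j)) (iota 0 (size b))
    & all (fun i => all (fun j =>
        horner_entry (size b) (sym_entry T) p i j == 0) (iota 0 (size b)))
        (iota 0 (size b))].

Lemma sym_entryC (T : seq (seq int)) (i j : nat) :
  sym_entry T i j = sym_entry T j i.
Proof. by rewrite /sym_entry minnC maxnC. Qed.

Lemma horner_entry_cons (n : nat) (f : nat -> nat -> int) (c : int)
    (p : seq int) (i j : nat) :
  horner_entry n f (c :: p) i j =
  \sum_(k < n) horner_entry n f p i k * f k j + (if i == j then c else 0).
Proof.
rewrite -(big_mkord predT (fun k => horner_entry n f p i k * f k j)).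
rewrite /index_iota subn0.
rewrite -[LHS]/(foldr (fun k x => horner_entry n f p i k * f k j + x)
                  (if i == j then c else 0) (iota 0 n)).
elim: (iota 0 n) => [|k s IHs] /=.
  by rewrite big_nil add0r.
by rewrite big_cons -addrA -IHs.
Qed.

(** Carries the integer computation over to any commutative ring, so that one check serves every
    [R]. *)
Lemma horner_mx_entry (R : comNzRingType) (n : nat) (f : nat -> nat -> int)
    (p : seq int) :
  horner_mx (\matrix_(i < n.+1, j < n.+1) (f i j)%:~R : 'M[R]_n.+1)
    (Poly (map intr p)) =
  \matrix_(i, j) (horner_entry n.+1 f p i j)%:~R.
Proof.
set A := \matrix_(i, j) _; elim: p => [|c p IHp].
  by rewrite rmorph0; apply/matrixP => i j; rewrite !mxE.
have -> : Poly (map intr (c :: p)) =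
    Poly (map intr p) * 'X + (c%:~R)%:P :> {poly R}.
  by rewrite -cons_poly_def.
rewrite rmorphD rmorphM /= horner_mx_X horner_mx_C IHp.
apply/matrixP => i j; rewrite !mxE horner_entry_cons rmorphD rmorph_sum /=.
congr (_ + _); first by apply: eq_bigr => k _; rewrite !mxE intrM.
by rewrite -val_eqE /=; case: eqP.
Qed.

Lemma q_threshold_le (R : realType) (b : seq bool) (T : seq (seq int))
    (p : seq int) :
  annihilated_certificate b T p ->
  (q_graph R (threshold_graph b) <= (size p).-1)%N.
Proof.
case: b => [|x b] // /and4P[_ last_p /allP pattern /allP pT0].
pose A : 'M[R]_((size b).+1) := \matrix_(i, j) (sym_entry T i j)%:~R.
have GA : sym_matrices R (threshold_graph (x :: b)) A.
  split=> [|i j ij]; first by apply/matrixP => i j; rewrite !mxE sym_entryC.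
  have patternE (k l : 'I_((size b).+1)) : (k < l)%N ->
      (sym_entry T k l != 0) = nth false (x :: b) l.
    move=> kl; have /pattern/allP/(_ (val k)) l_ok :
        val l \in iota 0 (size (x :: b)).
      by rewrite mem_iota /= add0n.
    by rewrite -(eqP (l_ok _)) ?mem_iota.
  rewrite mxE intr_eq0 /= /threshold_adj; move: ij; rewrite -val_eqE.
  case: ltngtP => //= [ij|ji] _; first by rewrite orbF patternE.
  by rewrite sym_entryC patternE.
have last_pR : last 0%:~R (map intr p) != 0 :> R by rewrite last_map intr_eq0.
have size_p : size (Poly (map intr p) : {poly R}) = size p.
  by rewrite (PolyK last_pR) size_map.
have p0 : Poly (map intr p) != 0 :> {poly R}.
  by rewrite -size_poly_eq0 size_p size_eq0; apply: contraNneq last_p => ->.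
apply: (q_graph_le GA); rewrite -ltnS prednK; last first.
  by rewrite -size_p lt0n size_poly_eq0.
rewrite -size_p; apply: (q_mx_le (proj1 GA) p0).
rewrite horner_mx_entry; apply/matrixP => i j; rewrite !mxE.
have /pT0/allP ij0 : val i \in iota 0 (size (x :: b)) by rewrite mem_iota /=.
apply/eqP; rewrite intr_eq0; apply: (ij0 (val j)).
by rewrite mem_iota /=.
Qed.

(* The annihilating polynomials are X^2 - t X: the matrices are multiples of
   orthogonal projections of rank at most 3. *)
Definition quadratic_certificates : seq (seq bool * seq (seq int) * seq int) :=
  [::
   (bits 0101011,
    [:: [:: 21; 21; 0; 21; 0; -21; -21];
        [:: 21; 0; 21; 0; -21; -21]; [:: 15; 30; 0; 15; 15]; [:: 81; 0; 9; 9];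
        [:: 35; -35; 35]; [:: 71; 1]; [:: 71]],
    [:: 0; -105; 1]);
   (bits 0100111,
    [:: [:: 5; 10; 0; 0; 5; 10; 10];
        [:: 20; 0; 0; 10; 20; 20]; [:: 7; 0; 14; 7; -14]; [:: 7; 14; -14; 7];
        [:: 61; -4; -4]; [:: 55; -8]; [:: 55]],
    [:: 0; -70; 1]);
   (bits 0011011,
    [:: [:: 24; 0; 24; 24; 0; -24; -24];
        [:: 60; 30; 30; 0; 30; 30]; [:: 39; 39; 0; -9; -9]; [:: 39; 0; -9; -9];
        [:: 40; -40; 40]; [:: 79; -1]; [:: 79]],
    [:: 0; -120; 1]);
   (bits 0010111,
    [:: [:: 2; 0; 2; 0; -4; 2; 2];
        [:: 1; -3; 0; -1; -1; 2]; [:: 11; 0; -1; 5; -4]; [:: 4; 4; 4; 4];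
        [:: 13; 1; -2]; [:: 7; 4]; [:: 10]],
    [:: 0; -16; 1]);
   (bits 0001111,
    [:: [:: 1; 0; 0; 1; -1; -1; -1];
        [:: 1; 0; 1; -1; 1; 1]; [:: 1; 1; 1; -1; 1]; [:: 3; -1; -1; 1];
        [:: 3; -1; 1]; [:: 3; 1]; [:: 3]],
    [:: 0; -5; 1]);
   (bits 0101111,
    [:: [:: 1; 2; 0; -1; -1; -2; -2];
        [:: 4; 0; -2; -2; -4; -4]; [:: 3; -3; 3; -3; 3]; [:: 4; -2; 5; -1];
        [:: 4; -1; 5]; [:: 7; 1]; [:: 7]],
    [:: 0; -15; 1]);
   (bits 0110111,
    [:: [:: 1; 1; 2; 0; -2; -1; -1];
        [:: 1; 2; 0; -2; -1; -1]; [:: 4; 0; -4; -2; -2]; [:: 3; -3; 3; 3];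
        [:: 7; -1; -1]; [:: 4; 4]; [:: 4]],
    [:: 0; -12; 1]);
   (bits 0111011,
    [:: [:: 1; 1; 1; 1; 0; -1; -1];
        [:: 1; 1; 1; 0; -1; -1]; [:: 1; 1; 0; -1; -1]; [:: 1; 0; -1; -1];
        [:: 2; -2; 2]; [:: 3; -1]; [:: 3]],
    [:: 0; -6; 1]);
   (bits 0111111,
    [:: [:: 1; 1; 1; 1; 1; 1; 1];
        [:: 1; 1; 1; 1; 1; 1]; [:: 1; 1; 1; 1; 1]; [:: 1; 1; 1; 1];
        [:: 1; 1; 1]; [:: 1; 1]; [:: 1]],
    [:: 0; -7; 1])]%Z.

(* Found by computer search. *)
Definition cubic_certificates : seq (seq bool * seq (seq int) * seq int) :=
  [::
   (bits 0000001,
    [:: [:: 0; 0; 0; 0; 0; 0; 1];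
        [:: 0; 0; 0; 0; 0; 1]; [:: 0; 0; 0; 0; 1]; [:: 0; 0; 0; 1];
        [:: 0; 0; 1]; [:: 0; 1]; [:: 0]],
    [:: 0; -6; 0; 1]);
   (bits 0100001,
    [:: [:: -1; 1; 0; 0; 0; 0; 1];
        [:: -1; 0; 0; 0; 0; 1]; [:: 0; 0; 0; 0; 1]; [:: 0; 0; 0; 1];
        [:: 0; 0; 1]; [:: 0; 1]; [:: 1]],
    [:: 0; -6; -1; 1]);
   (bits 0010001,
    [:: [:: -2; 0; 2; 0; 0; 0; 1];
        [:: 1; -1; 0; 0; 0; 1]; [:: -1; 0; 0; 0; 1]; [:: 0; 0; 0; 1];
        [:: 0; 0; 1]; [:: 0; 1]; [:: -2]],
    [:: 0; -6; 2; 1]);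
   (bits 0000101,
    [:: [:: 4; 0; 0; 0; -3; 0; 3];
        [:: 4; 0; 0; -3; 0; 3]; [:: 4; 0; -3; 0; 3]; [:: 4; -3; 0; 3];
        [:: 9; 0; 4]; [:: 5; 4]; [:: 7]],
    [:: 260; -33; -12; 1]);
   (bits 0000011,
    [:: [:: 0; 0; 0; 0; 0; 1; 1];
        [:: 0; 0; 0; 0; 1; 1]; [:: 0; 0; 0; 1; 1]; [:: 0; 0; 1; 1];
        [:: 0; 1; 1]; [:: 1; 1]; [:: 1]],
    [:: 0; -10; -2; 1]);
   (bits 0110001,
    [:: [:: -2; 1; 1; 0; 0; 0; 1];
        [:: -2; 1; 0; 0; 0; 1]; [:: -2; 0; 0; 0; 1]; [:: 0; 0; 0; 1];
        [:: 0; 0; 1]; [:: 0; 1]; [:: -1]],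
    [:: 0; -6; 1; 1]);
   (bits 0101001,
    [:: [:: 1; 1; 0; -1; 0; 0; 1];
        [:: 1; 0; -1; 0; 0; 1]; [:: -3; 3; 0; 0; 2]; [:: -2; 0; 0; 2];
        [:: 0; 0; 1]; [:: 0; 2]; [:: -3]],
    [:: 0; -15; 3; 1]);
   (bits 0100101,
    [:: [:: 1; 2; 0; 0; -3; 0; 1];
        [:: 1; 0; 0; -3; 0; 1]; [:: -1; 0; 2; 0; 2]; [:: -1; 2; 0; 2];
        [:: -2; 0; 1]; [:: -3; 4]; [:: 2]],
    [:: -33; -33; 1; 1]);
   (bits 0100011,
    [:: [:: 1; -1; 0; 0; 0; 1; 1];
        [:: 1; 0; 0; 0; 1; 1]; [:: 0; 0; 0; 1; 1]; [:: 0; 0; 1; 1];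
        [:: 0; 1; 1]; [:: -4; 1]; [:: -4]],
    [:: 0; -10; 3; 1]);
   (bits 0011001,
    [:: [:: 0; 0; 3; 3; 0; 0; 1];
        [:: 0; 3; 3; 0; 0; -1]; [:: -1; -1; 0; 0; 1]; [:: -1; 0; 0; -1];
        [:: 0; 0; 4]; [:: 0; 4]; [:: -2]],
    [:: 0; -36; 2; 1]);
   (bits 0010101,
    [:: [:: -3; 0; 3; 0; 1; 0; 2];
        [:: -3; 3; 0; 1; 0; 2]; [:: 0; 0; -4; 0; 1]; [:: -2; 2; 0; 3];
        [:: -2; 0; 3]; [:: -4; 3]; [:: -3]],
    [:: -108; -24; 7; 1]);
   (bits 0010011,
    [:: [:: 4; 0; -4; 0; 0; 1; 1];
        [:: -2; 4; 0; 0; 2; 2]; [:: -4; 0; 0; 1; 1]; [:: 0; 0; 3; 3];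
        [:: 0; 3; 3]; [:: -1; -1]; [:: -1]],
    [:: 0; -48; 2; 1]);
   (bits 0001101,
    [:: [:: 0; 0; 0; 2; 2; 0; 1];
        [:: 0; 0; 2; 2; 0; 1]; [:: 0; 2; 2; 0; -2]; [:: -1; -1; 0; 1];
        [:: -1; 0; -1]; [:: 0; 4]; [:: -2]],
    [:: 0; -24; 2; 1]);
   (bits 0001011,
    [:: [:: 6; 0; 0; -4; 0; 2; 2];
        [:: 6; 0; -4; 0; 2; 2]; [:: 6; -4; 0; 2; 2]; [:: 8; 0; 3; 3];
        [:: 12; 3; 3]; [:: 4; -2]; [:: 4]],
    [:: 504; -36; -14; 1]);
   (bits 0000111,
    [:: [:: 0; 0; 0; 0; 1; 1; 1];
        [:: 0; 0; 0; 1; 1; 1]; [:: 0; 0; 1; 1; 1]; [:: 0; 1; 1; 1];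
        [:: 1; 1; 1]; [:: 1; 1]; [:: 1]],
    [:: 0; -12; -3; 1]);
   (bits 0111001,
    [:: [:: -3; 1; 1; 1; 0; 0; 1];
        [:: -3; 1; 1; 0; 0; 1]; [:: -3; 1; 0; 0; 1]; [:: -3; 0; 0; 1];
        [:: 0; 0; 2]; [:: 0; 2]; [:: -1]],
    [:: 0; -12; 1; 1]);
   (bits 0110101,
    [:: [:: 1; 1; 1; 0; -3; 0; 1];
        [:: 1; 1; 0; -3; 0; 1]; [:: 1; 0; -3; 0; 1]; [:: -1; 2; 0; 2];
        [:: 5; 0; 1]; [:: 0; 4]; [:: 7]],
    [:: 0; -24; -7; 1]);
   (bits 0110011,
    [:: [:: 4; -2; -2; 0; 0; 1; 1];
        [:: 4; -2; 0; 0; 1; 1]; [:: 4; 0; 0; 1; 1]; [:: 0; 0; 3; 3];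
        [:: 0; 3; 3]; [:: -4; 3]; [:: -4]],
    [:: 0; -42; 1; 1]);
   (bits 0101101,
    [:: [:: 1; 1; 0; -1; -1; 0; 1];
        [:: 1; 0; -1; -1; 0; 1]; [:: -3; 3; 3; 0; 2]; [:: -2; -2; 0; 1];
        [:: -2; 0; 1]; [:: 0; 4]; [:: -5]],
    [:: 0; -24; 5; 1]);
   (bits 0011101,
    [:: [:: 0; 0; 2; 2; -2; 0; 1];
        [:: 0; -2; -2; 2; 0; 1]; [:: 1; 1; -1; 0; 1]; [:: 1; -1; 0; 1];
        [:: 1; 0; 2]; [:: 0; 4]; [:: 3]],
    [:: 0; -24; -3; 1]);
   (bits 0111101,
    [:: [:: -4; 1; 1; 1; 1; 0; 1];
        [:: -4; 1; 1; 1; 0; 1]; [:: -4; 1; 1; 0; 1]; [:: -4; 1; 0; 1];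
        [:: -4; 0; 1]; [:: 0; 5]; [:: 1]],
    [:: 0; -30; -1; 1])]%Z.

(** The matrix is constant on the twin classes v_1, v_2, v_3 and v_5, v_6, which gives eigenvalues 1
    and 0. The polynomial is X (X - 1) (X^2 - 2 X - 12), and its other roots are 1 + sqrt 13 and 1 -
    sqrt 13. *)
Lemma q_0001001_le4 (R : realType) :
  (q_graph R (threshold_graph (bits 0001001)) <= 4)%N.
Proof.
apply: (@q_threshold_le R (bits 0001001)
    [:: [:: 1; 0; 0; 1; 0; 0; 1];
        [:: 1; 0; 1; 0; 0; 1]; [:: 1; 1; 0; 0; 1]; [:: 3; 0; 0; 1];
        [:: 0; 0; 1]; [:: 0; 1]; [:: -1]]%Z
    [:: 0; 12; -10; -3; 1]%Z).
by vm_compute.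
Qed.

Definition certifies (d : nat) (c : seq bool * seq (seq int) * seq int) :=
  annihilated_certificate c.1.1 c.1.2 c.2 && (size c.2 == d.+1).

Lemma quadratic_certificates_ok : all (certifies 2) quadratic_certificates.
Proof. by vm_compute. Qed.

Lemma cubic_certificates_ok : all (certifies 3) cubic_certificates.
Proof. by vm_compute. Qed.

Lemma q_certificates_le (R : realType) (d : nat)
    (s : seq (seq bool * seq (seq int) * seq int)) (b : seq bool) :
  all (certifies d) s ->
  b \in [seq c.1.1 | c <- s] -> (q_graph R (threshold_graph b) <= d)%N.
Proof.
move=> /allP s_ok /mapP[[[b' T] p] /s_ok/andP[/= ok /eqP size_p] ->].
by have := q_threshold_le R ok; rewrite size_p.
Qed.

(* Nonadjacent vertices i < j have as common neighbours exactly the later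
   dominating ones: in a suffix with at least as many 0s as 1s, the 0s together
   with the first vertex outnumber their possible common neighbours. *)
Definition balanced_suffix (b : seq bool) : bool :=
  has (fun s => (count id (drop s b) <= count negb (drop s b))%N)
    (iota 1 (size b).-1).

Lemma balanced_suffix_gt2 (R : realType) (b : seq bool) :
  last false b -> balanced_suffix b -> (2 < q_graph R (threshold_graph b))%N.
Proof.
move=> lastb /hasP[s]; rewrite mem_iota => /andP[s0 sb] cb.
apply: (q_threshold_gt2 R _ lastb cb).
by case: (b) lastb sb => //= x c _; rewrite s0.
Qed.

(** * Exclusion of three eigenvalues for 0001001 *)

(* Vertices v_1, v_2, v_3 are indexed by 'I_3 and have diagonal entries [d i];
   [a i], [b i] join them to v_4, v_7, and [e], [e'] join v_5, v_6 to v_7;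
   [x], [y] are the diagonal entries at v_4, v_7 and [z] joins them.  The
   hypotheses are the entries (5,6), (i,5), (i,6), (4,5), (i,j), (1,4), (5,7) of
   A^3 = c0 + c1 A + c2 A^2.  They force d4 = d5, and after a shift to d4 = 0 a
   common ratio q = a i / b i, then c1 = z q (x - z q) = - q^2 S - z^2 q^2 from
   (1,4), where S is the sum of the (b i)^2, but c1 = S + z^2 + e^2 + e'^2 from
   (5,7). *)
Lemma cubic_0001001_contra (R : realFieldType) (a b d : 'I_3 -> R)
    (x y z e e' d4 d5 c1 c2 : R) :
  (forall i, a i != 0) -> (forall i, b i != 0) -> z != 0 -> e != 0 -> e' != 0 ->
  e * e' * (y + d4 + d5) = c2 * (e * e') ->
  (forall i,
     e * (b i * y + a i * z + d i * b i + b i * d4) = c2 * (b i * e)) ->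
  (forall i,
     e' * (b i * y + a i * z + d i * b i + b i * d5) = c2 * (b i * e')) ->
  e * (\sum_i a i * b i + x * z + z * y + z * d4) = c2 * (z * e) ->
  (forall i j, i != j ->
     x * a i * a j + y * b i * b j + z * (a i * b j + b i * a j) +
     (d i + d j) * (a i * a j + b i * b j) = c2 * (a i * a j + b i * b j)) ->
  d 0 * (d 0 * a 0 + a 0 * x + b 0 * z) +
    a 0 * (\sum_i a i ^+ 2 + x ^+ 2 + z ^+ 2) +
    b 0 * (\sum_i a i * b i + x * z + z * y) =
    c2 * (d 0 * a 0 + a 0 * x + b 0 * z) + c1 * a 0 ->
  e * (d4 * (d4 + y) + \sum_i b i ^+ 2 + z ^+ 2 + e ^+ 2 + e' ^+ 2 + y ^+ 2) =
    c2 * (e * (d4 + y)) + c1 * e ->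
  False.
Proof.
move=> a0 b0 z0 e0 e'0 H45 Hi4 Hi5 H34 Hij H03 H46.
have ee' : e * e' != 0 by rewrite mulf_neq0.
have c2E : c2 = y + d4 + d5 by apply: (mulfI ee'); rewrite H45 mulrC.
have az5 i : a i * z = b i * (d5 - d i).
  by apply: (mulfI e0); have := Hi4 i; rewrite c2E; lra.
have az4 i : a i * z = b i * (d4 - d i).
  by apply: (mulfI e'0); have := Hi5 i; rewrite c2E; lra.
have d45 : d5 = d4.
  by apply/(addIr (- d 0))/(mulfI (b0 0)); rewrite -az4 -az5.
subst d5 c2.
pose r i := a i / b i.
have aE i : a i = r i * b i by rewrite /r divfK.
have r0 i : r i != 0 by rewrite /r mulf_neq0 ?invr_eq0.
have dE i : d i = d4 - z * r i.
  by apply: (mulfI (b0 i)); have := az4 i; rewrite aE; lra.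
have xE i j : i != j -> x = y + z * (r i + r j).
  move=> ij; have bb := mulf_neq0 (b0 i) (b0 j).
  apply: (mulfI (mulf_neq0 bb (mulf_neq0 (r0 i) (r0 j)))).
  by have := Hij i j ij; rewrite !aE !dE; lra.
have rE i : r i = r 0.
  have [->//|i0] := eqVneq i 0.
  (* A third index [k] allows [x] to be computed from both pairs (i, k) and (0, k). *)
  have [k ik k0] : exists2 k : 'I_3, i != k & 0 != k.
    case: i i0 => [[|[|[|//]]] i_lt] // _.
      by exists (@Ordinal 3 2 isT).
    by exists (@Ordinal 3 1 isT).
  apply: (mulfI z0); have := xE i k ik; rewrite (xE 0 k k0); lra.
set S := \sum_i b i ^+ 2 in H46.
have abS : \sum_i a i * b i = r 0 * S.
  by rewrite mulr_sumr; apply: eq_bigr => i _; rewrite aE rE; ring.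
have aaS : \sum_i a i ^+ 2 = r 0 ^+ 2 * S.
  by rewrite mulr_sumr; apply: eq_bigr => i _; rewrite aE rE; ring.
have S_ge0 : 0 <= S by apply: sumr_ge0 => i _; apply: sqr_ge0.
rewrite abS aaS aE dE in H03; rewrite abS in H34.
have xy : x = y + z * (r 0 + r 0) by rewrite -{2}(rE 1) (xE 0 1).
move: (r 0) (r0 0) xy H03 H34 => q q0 xy H03 H34.
have qS : q * S = (d4 - x) * z by apply: (mulfI e0); lra.
have c1E : c1 = S + z ^+ 2 + e ^+ 2 + e' ^+ 2 - 2 * d4 * y - d4 ^+ 2.
  by apply: (mulfI e0); lra.
rewrite c1E in H03; subst x.
(* The terms in [d4] cancel. Since [lra] is linear, the multiples of [qS] are supplied by hand. The
   second factor is positive because [e] is nonzero. *)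
have H : (q * b 0) *
    (S + z ^+ 2 + e ^+ 2 + e' ^+ 2 + q ^+ 2 * S + z ^+ 2 * q ^+ 2) = 0.
  have E1 := congr1 ( *%R (b 0)) qS.
  have E2 := congr1 ( *%R (b 0 * q ^+ 2)) qS.
  have E3 := congr1 ( *%R (b 0 * q)) qS.
  lra.
move/eqP: H; rewrite mulf_eq0 (negPf (mulf_neq0 q0 (b0 0))) /= => /eqP.
have := sqr_ge0 (z * q); have := sqr_ge0 e'; have := sqr_ge0 z.
have : 0 < e ^+ 2 by rewrite exprn_even_gt0.
have := mulr_ge0 (sqr_ge0 q) S_ge0.
rewrite exprMn; lra.
Qed.

Lemma q_0001001_gt3 (R : realType) :
  (3 < q_graph R (threshold_graph (bits 0001001)))%N.
Proof.
apply: (@q_graph_gt R 7) => A [sA GA]; apply/negP => /(expmx_q_mx_le sA)[c].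
rewrite !big_ord_recl big_ord0 /= addr0 /bump /= expr0 expr1 => A3.
pose M (k l : nat) := A (inord k) (inord l).
have sum7 (F : 'I_7 -> R) : \sum_k F k =
    F (inord 0) + (F (inord 1) + (F (inord 2) + (F (inord 3) +
    (F (inord 4) + (F (inord 5) + F (inord 6)))))).
  rewrite !big_ord_recl big_ord0 addr0.
  by do !congr (_ + _); congr F; apply/val_inj; rewrite /= inordK.
have M2 k l : (A ^+ 2) (inord k) (inord l) = M k 0 * M 0 l + (M k 1 * M 1 l +
    (M k 2 * M 2 l + (M k 3 * M 3 l + (M k 4 * M 4 l + (M k 5 * M 5 l +
     M k 6 * M 6 l))))).
  by rewrite expr2 mxE sum7.
(* Off the diagonal the coefficient of the identity drops out of the cubic relation. *)
have M3 k l : k != l -> (k < 7)%N -> (l < 7)%N ->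
    c 1%N * M k l + c 2%N * (A ^+ 2) (inord k) (inord l) =
    M k 0 * (A ^+ 2) (inord 0) (inord l) +
    (M k 1 * (A ^+ 2) (inord 1) (inord l) +
    (M k 2 * (A ^+ 2) (inord 2) (inord l) +
    (M k 3 * (A ^+ 2) (inord 3) (inord l) +
    (M k 4 * (A ^+ 2) (inord 4) (inord l) +
    (M k 5 * (A ^+ 2) (inord 5) (inord l) +
     M k 6 * (A ^+ 2) (inord 6) (inord l)))))).
  move=> kl k7 l7; have /matrixP/(_ (inord k) (inord l)) := A3.
  rewrite {1}exprS mxE sum7 => ->.
  by rewrite !mxE -val_eqE /= !inordK // (negPf kl) mulr0n mulr0 add0r.
have MC k l : M k l = M l k by rewrite /M -{1}sA mxE.
have MG k l : k != l -> (k < 7)%N -> (l < 7)%N ->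
    (M k l != 0) = (k < l)%N && nth false (bits 0001001) l ||
                   (l < k)%N && nth false (bits 0001001) k.
  move=> kl k7 l7; have := GA (inord k) (inord l).
  rewrite -val_eqE /= !inordK // => /(_ kl) ->.
  by rewrite /threshold_adj !inordK.
have M_0 k l : k != l -> (k < 7)%N -> (l < 7)%N ->
    ~~ ((k < l)%N && nth false (bits 0001001) l ||
        (l < k)%N && nth false (bits 0001001) k) -> M k l = 0.
  by move=> kl k7 l7; rewrite -(MG k l) // negbK => /eqP.
(* [non] and [up] are products of equations, usable as multirules: they erase the nonedges and write
   each entry in its upper triangular form, leaving [lra] one atom per entry. *)
have non : (M 0 1 = 0) * (M 0 2 = 0) * (M 1 2 = 0) * (M 0 4 = 0) * (M 0 5 = 0) *
    (M 1 4 = 0) * (M 1 5 = 0) * (M 2 4 = 0) * (M 2 5 = 0) * (M 3 4 = 0) *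
    (M 3 5 = 0) * (M 4 5 = 0) by do !split; apply: M_0.
have up : (M 1 0 = M 0 1) * (M 2 0 = M 0 2) * (M 2 1 = M 1 2) *
    (M 3 0 = M 0 3) * (M 3 1 = M 1 3) * (M 3 2 = M 2 3) *
    (M 4 0 = M 0 4) * (M 4 1 = M 1 4) * (M 4 2 = M 2 4) * (M 4 3 = M 3 4) *
    (M 5 0 = M 0 5) * (M 5 1 = M 1 5) * (M 5 2 = M 2 5) * (M 5 3 = M 3 5) *
    (M 5 4 = M 4 5) * (M 6 0 = M 0 6) * (M 6 1 = M 1 6) * (M 6 2 = M 2 6) *
    (M 6 3 = M 3 6) * (M 6 4 = M 4 6) * (M 6 5 = M 5 6) by do !split; apply: MC.
apply: (@cubic_0001001_contra R
  (fun i => M i 3) (fun i => M i 6) (fun i => M i i) (M 3 3) (M 6 6) (M 3 6)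
  (M 4 6) (M 5 6) (M 4 4) (M 5 5) (c 1%N) (c 2%N)).
- by move=> i; rewrite MG //; case: i => [[|[|[|]]]].
- by move=> i; rewrite MG //; case: i => [[|[|[|]]]].
- by rewrite MG.
- by rewrite MG.
- by rewrite MG.
(* Positions count from 0: [M3 4 5] is the entry (5,6) of the relation. *)
- have := M3 4 5 isT isT isT; rewrite !M2 !up !non; lra.
- case=> [[|[|[|//]]] i3] /=; [have := M3 0 4 isT isT isT
    | have := M3 1 4 isT isT isT | have := M3 2 4 isT isT isT];
    rewrite !M2 !up !non; lra.
- case=> [[|[|[|//]]] i3] /=; [have := M3 0 5 isT isT isT
    | have := M3 1 5 isT isT isT | have := M3 2 5 isT isT isT];
    rewrite !M2 !up !non; lra.
- rewrite !big_ord_recl big_ord0 /= /bump /=.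
  have := M3 3 4 isT isT isT; rewrite !M2 !up !non; lra.
- case=> [[|[|[|//]]] i3]; case=> [[|[|[|//]]] j3] //= _;
    [have := M3 0 1 isT isT isT | have := M3 0 2 isT isT isT
    | have := M3 1 0 isT isT isT | have := M3 1 2 isT isT isT
    | have := M3 2 0 isT isT isT | have := M3 2 1 isT isT isT];
    rewrite !M2 !up !non; lra.
- rewrite !big_ord_recl !big_ord0 /= /bump /=.
  have := M3 0 3 isT isT isT; rewrite !M2 !up !non; lra.
- rewrite !big_ord_recl big_ord0 /= /bump /=.
  have := M3 4 6 isT isT isT; rewrite !M2 !up !non; lra.
Qed.

(* The values of q for the listed sequences *)
Local Close Scope ring_scope.
Local Close Scope classical_set_scope.

Theorem mainTheorem12 (R : realType) :
  [/\ q_graph R (threshold_graph (bits 0001001)) = 4,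
      forall b : seq bool,
        b \in [:: bits 0101011; bits 0100111; bits 0011011; bits 0010111;
            bits 0001111; bits 0101111; bits 0110111; bits 0111011;
            bits 0111111] ->
        q_graph R (threshold_graph b) = 2
    & forall b : seq bool,
        b \in [:: bits 0000001; bits 0100001; bits 0010001; bits 0000101;
            bits 0000011; bits 0110001; bits 0101001; bits 0100101;
            bits 0100011; bits 0011001; bits 0010101; bits 0010011;
            bits 0001101; bits 0001011; bits 0000111; bits 0111001;
            bits 0110101; bits 0110011; bits 0101101; bits 0011101;
            bits 0111101] ->
        q_graph R (threshold_graph b) = 3].
Proof.
split=> [|b b_in|b b_in]; apply/eqP; rewrite eqn_leq; apply/andP; split.
- exact: q_0001001_le4.
- exact: q_0001001_gt3.
(* The list in the statement is convertible to the first components of the certificates, which come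
   in the same order. *)
- exact: q_certificates_le quadratic_certificates_ok b_in.
- have /allP/(_ b b_in)/andP[] :
    all (fun b => (1 < size b)%N && last false b)
      [seq c.1.1 | c <- quadratic_certificates] by vm_compute.
  exact: q_threshold_gt1.
- exact: q_certificates_le cubic_certificates_ok b_in.
- have /allP/(_ b b_in)/andP[] :
    all (fun b => last false b && balanced_suffix b)
      [seq c.1.1 | c <- cubic_certificates] by vm_compute.
  exact: balanced_suffix_gt2.
Qed.
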